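(* Let $G=(V,E)$ be an unweighted undirected graph with $n=|V|$ and $m=|E|$. The subgraph $H$ produced by the construction described in the context is a $5$-additive spanner of $G$, i.e. $\mathrm{dist}_H(u,v)\le \mathrm{dist}_G(u,v)+5$ for all $u,v\in V$.
   Context: A $k$-additive spanner of an unweighted undirected graph $G=(V,E)$ is a subgraph $H=(V,E')$, $E'\subseteq E$, with $\mathrm{dist}_H(u,v)\le\mathrm{dist}_G(u,v)+k$ for all $u,v$. A set $S$ dominates a set $X$ of vertices if every vertex of $X$ is in $S$ or adjacent to a vertex of $S$; dominating sets are computed by the greedy algorithm (repeatedly select the vertex covering the largest number of currently undominated target vertices until all targets are dominated). The construction: initialize $G'=(V',E')=(V,E)$ and $H=(V,\emptyset)$. Step 1: while the vertex $v\in V'$ of largest degree satisfies $\deg_{G'}(v)\ge n^{3/5}/\log^{3/5}n$, add a BFS tree of $G'$ rooted at $v$ to $H$ and remove $v$ and all its neighbors from $G'$. Afterwards a vertex $v\in V'$ is heavy if $\deg_{G'}(v)\ge n^{2/5}\log^{3/5}n$ and light otherwise. Step 2: for each light $u\in V'$, add all edges of $G'$ incident to $u$ to $H$. Step 3: compute (greedily) $S_1\subseteq V'$ dominating all heavy vertices in $G'$, and for each heavy vertex add to $H$ an edge connecting it to some vertex of $S_1$. Step 4: for each $v\in S_1$, compute a BFS tree $T_v$ of $G'$ rooted at $v$ such that for every $u\in V'$ the tree path from $v$ to $u$ minimizes the total vertex degree (in $G'$) along the path; let $p_{v,u}$ be the parent of $u$ in $T_v$, set $f_{v,v}=\deg_{G'}(v)$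 and $f_{v,u}=f_{v,p_{v,u}}+\deg_{G'}(u)$, and let $s_{v,u}$ be the sum of $G'$-degrees of vertices in the subtree of $T_v$ rooted at $u$. Step 5: build a bipartite graph $B=(L,R,C)$ with $L=V'$: for each $v\in S_1$ and $u\in V'$ with $f_{v,u}>n^{3/5}\log^{2/5}n$, $f_{v,p_{v,u}}\le n^{3/5}\log^{2/5}n$ and $s_{v,u}>3n^{3/5}\log^{2/5}n$, put a node $(v,u)$ in $R$ and join it in $C$ to every $x\in V'$ adjacent (in $G'$) to some vertex on the $v$--$u$ path in $T_v$. Step 6: compute (greedily) $S_2\subseteq L$ dominating all vertices of $R$ in $B$, and for each $x\in S_2$ add a BFS tree of $G'$ rooted at $x$ to $H$. Step 7: for each $v,u\in S_1$ with $f_{v,u}\le 5n^{3/5}\log^{2/5}n$, add the $v$--$u$ path in $T_v$ to $H$. *)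

(* Defs.v *)
From HB Require Import structures.
From mathcomp Require Import all_boot all_order all_algebra.
From mathcomp Require Import all_classical all_reals all_analysis.
(* after MathComp-Analysis, so that [set0] and [setT] are finite sets *)
From mathcomp Require Import finset.

Set Implicit Arguments.
Unset Strict Implicit.
Unset Printing Implicit Defensive.

Import Order.TTheory GRing.Theory Num.Theory.
Local Open Scope ring_scope.

(* A graph on the finite vertex type [V] is a set of two-element sets. *)
Definition simple_graph (V : finType) (E : {set {set V}}) : Prop :=
  forall d, d \in E -> #|d| = 2%N.

Definition adj (V : finType) (E : {set {set V}}) : rel V :=
  fun x y => [set x; y] \in E.

(* The edges of the subgraph induced by [A].  It stays a graph on the type [V];
   the vertices outside [A] become isolated. *)
Definition induced (V : finType) (E : {set {set V}}) (A : {set V}) :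
    {set {set V}} :=
  [set d in E | d \subset A].

Definition deg (V : finType) (E : {set {set V}}) (v : V) : nat :=
  #|[set w | adj E v w]|.

Definition dominates (V : finType) (E : {set {set V}}) (x y : V) : bool :=
  (x == y) || adj E x y.

(* The vertices of the walk are [u :: s], so its length is [size s]. *)
Definition walk (V : finType) (r : rel V) (u v : V) (s : seq V) : bool :=
  path r u s && (last u s == v).

Definition geodesic (V : finType) (E : {set {set V}}) (u v : V) (s : seq V) :
    Prop :=
  walk (adj E) u v s /\ forall t, walk (adj E) u v t -> (size s <= size t)%N.

(* [+oo] when [u] and [v] are not connected. *)
Definition dist (R : realType) (V : finType) (E : {set {set V}}) (u v : V) :
    \bar R :=
  ereal_inf [set ((size s)%:R)%:E | s in [set s | walk (adj E) u v s]]%classic.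

Definition additive_spanner (R : realType) (V : finType) (k : nat)
    (E H : {set {set V}}) : Prop :=
  H \subset E /\
  forall u v : V, (dist R H u v <= dist R E u v + (k%:R)%:E)%E.

(* A tree rooted at [v] that spans the connected component of [v] is given by
   its parent map [p]; the values of [p] at [v] and outside the component are
   irrelevant.  [arc E v p x y] says that [x] is the parent of [y]. *)
Definition in_tree (V : finType) (E : {set {set V}}) (v u : V) : bool :=
  connect (adj E) v u.

Definition arc (V : finType) (E : {set {set V}}) (v : V) (p : V -> V) : rel V :=
  fun x y => [&& in_tree E v y, y != v & p y == x].

Definition bfs_tree (V : finType) (E : {set {set V}}) (v : V) (p : V -> V) :
    Prop :=
  forall u, in_tree E v u ->
  exists s, walk (arc E v p) v u s /\ geodesic E v u s.

Definition tree_edges (V : finType) (E : {set {set V}}) (v : V) (p : V -> V) :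
    {set {set V}} :=
  [set [set p y; y] | y in [set y | in_tree E v y & y != v]].

(* For [u] in the tree, the path from [v] to [u] consists of the
   ancestors of [u], itself included. *)
Definition tree_path (V : finType) (E : {set {set V}}) (v : V) (p : V -> V)
    (u : V) : {set V} :=
  [set w | connect (arc E v p) w u].

Definition tree_path_edges (V : finType) (E : {set {set V}}) (v : V)
    (p : V -> V) (u : V) : {set {set V}} :=
  [set [set p w; w] | w in tree_path E v p u :\ v].

Definition subtree (V : finType) (E : {set {set V}}) (v : V) (p : V -> V)
    (u : V) : {set V} :=
  [set w | connect (arc E v p) u w].

Definition walk_weight (V : finType) (E : {set {set V}}) (v : V) (s : seq V) :
    nat :=
  (\sum_(x <- v :: s) deg E x)%N.

(* Among the shortest paths of the graph from [v] to [u], the tree path has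
   the least total degree. *)
Definition min_degree_bfs_tree (V : finType) (E : {set {set V}}) (v : V)
    (p : V -> V) : Prop :=
  bfs_tree E v p /\
  forall u s t, walk (arc E v p) v u s -> geodesic E v u t ->
    (walk_weight E v s <= walk_weight E v t)%N.

Definition tree_weights (V : finType) (E : {set {set V}}) (v : V) (p : V -> V)
    (f : V -> nat) : Prop :=
  f v = deg E v /\
  forall u, in_tree E v u -> u != v -> f u = (f (p u) + deg E u)%N.

Definition subtree_weight (V : finType) (E : {set {set V}}) (v : V)
    (p : V -> V) (u : V) : nat :=
  (\sum_(w in subtree E v p u) deg E w)%N.

(* Greedy domination of the targets [X] by candidates from [C], where
   [cov x y] says that [x] covers [y]. *)

Definition undominated (T W : finType) (cov : T -> W -> bool) (X : {set W})
    (S : {set T}) : {set W} :=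
  [set y in X | [forall x in S, ~~ cov x y]].

Definition gain (T W : finType) (cov : T -> W -> bool) (X : {set W})
    (S : {set T}) (x : T) : nat :=
  #|[set y in undominated cov X S | cov x y]|.

Inductive greedy_partial (T W : finType) (cov : T -> W -> bool) (C : {set T})
    (X : {set W}) : {set T} -> Prop :=
| Greedy_start : greedy_partial cov C X set0
| Greedy_select S x :
    greedy_partial cov C X S ->
    undominated cov X S != set0 ->
    x \in C ->
    (forall y, y \in C -> (gain cov X S y <= gain cov X S x)%N) ->
    greedy_partial cov C X (x |: S).

Definition greedy_dominating (T W : finType) (cov : T -> W -> bool)
    (C : {set T}) (X : {set W}) (S : {set T}) : Prop :=
  greedy_partial cov C X S /\ undominated cov X S = set0.

(* All logarithms are binary. *)
Definition log2 (R : realType) (n : nat) : R := ln n%:R / ln 2.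

Definition removal_threshold (R : realType) (n : nat) : R :=
  n%:R `^ (3 / 5) / log2 R n `^ (3 / 5).

Definition heavy_threshold (R : realType) (n : nat) : R :=
  n%:R `^ (2 / 5) * log2 R n `^ (3 / 5).

Definition path_threshold (R : realType) (n : nat) : R :=
  n%:R `^ (3 / 5) * log2 R n `^ (2 / 5).

(* States [(V', H)] of the loop that removes vertices of large degree. *)
Inductive removal_loop (R : realType) (V : finType) (E : {set {set V}}) :
    {set V} -> {set {set V}} -> Prop :=
| Removal_start : removal_loop R E setT set0
| Removal_step A H v p :
    removal_loop R E A H ->
    v \in A ->
    (forall w, w \in A -> (deg (induced E A) w <= deg (induced E A) v)%N) ->
    removal_threshold R #|V| <= (deg (induced E A) v)%:R ->
    bfs_tree (induced E A) v p ->
    removal_loop R E (A :\: [set w | dominates (induced E A) v w])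
      (H :|: tree_edges (induced E A) v p).

Definition removal_phase (R : realType) (V : finType) (E : {set {set V}})
    (A : {set V}) (H : {set {set V}}) : Prop :=
  removal_loop R E A H /\
  forall v, v \in A -> (deg (induced E A) v)%:R < removal_threshold R #|V|.

(* From here on [A] is the final [V'] and [E'] the edge set of the final [G'];
   the sizes in the thresholds always refer to the original graph. *)

Definition heavy (R : realType) (V : finType) (A : {set V})
    (E' : {set {set V}}) : {set V} :=
  [set v in A | heavy_threshold R #|V| <= (deg E' v)%:R].

Definition light (R : realType) (V : finType) (A : {set V})
    (E' : {set {set V}}) : {set V} :=
  A :\: heavy R A E'.

Definition light_edges (R : realType) (V : finType) (A : {set V})
    (E' : {set {set V}}) : {set {set V}} :=
  [set d in E' | [exists u in light R A E', u \in d]].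

(* [c w] is the vertex of [S1] to which the heavy vertex [w] is connected;
   a heavy vertex that lies in [S1] may be its own dominator, in which case no
   edge is needed. *)
Definition dominator_map (R : realType) (V : finType) (A : {set V})
    (E' : {set {set V}}) (S1 : {set V}) (c : V -> V) : Prop :=
  forall w, w \in heavy R A E' -> c w \in S1 /\ dominates E' (c w) w.

Definition dominator_edges (R : realType) (V : finType) (A : {set V})
    (E' : {set {set V}}) (c : V -> V) : {set {set V}} :=
  [set [set w; c w] | w in [set w in heavy R A E' | c w != w]].

(* The right-hand nodes [(v, u)] of the bipartite graph whose edges are given
   by [path_incidence]; [u = v] is excluded since the root has no parent. *)
Definition path_nodes (R : realType) (V : finType) (E' : {set {set V}})
    (S1 : {set V}) (p : V -> V -> V) (f : V -> V -> nat) : {set V * V} :=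
  [set vu : V * V |
    [&& vu.1 \in S1, in_tree E' vu.1 vu.2, vu.2 != vu.1,
        path_threshold R #|V| < (f vu.1 vu.2)%:R,
        (f vu.1 (p vu.1 vu.2))%:R <= path_threshold R #|V| &
        3 * path_threshold R #|V|
          < (subtree_weight E' vu.1 (p vu.1) vu.2)%:R]].

Definition path_incidence (V : finType) (E' : {set {set V}})
    (p : V -> V -> V) (x : V) (vu : V * V) : bool :=
  [exists w in tree_path E' vu.1 (p vu.1) vu.2, adj E' x w].

Definition cheap_path_edges (R : realType) (V : finType) (E' : {set {set V}})
    (S1 : {set V}) (p : V -> V -> V) (f : V -> V -> nat) : {set {set V}} :=
  \bigcup_(v in S1)
    \bigcup_(u in S1 | in_tree E' v u
                       && ((f v u)%:R <= 5 * path_threshold R #|V|))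
      tree_path_edges E' v (p v) u.

(* [spanner_construction R E H]: some run of the construction on the graph [E],
   with arbitrary choices of trees, tie-breaks and dominators, outputs [H]. *)
Inductive spanner_construction (R : realType) (V : finType)
    (E : {set {set V}}) : {set {set V}} -> Prop :=
| Spanner_construction (A : {set V}) (H1 : {set {set V}}) (S1 : {set V})
    (c : V -> V) (p : V -> V -> V) (f : V -> V -> nat) (S2 : {set V})
    (q : V -> V -> V) :
    let E' := induced E A in
    removal_phase R E A H1 ->
    greedy_dominating (dominates E') A (heavy R A E') S1 ->
    dominator_map R A E' S1 c ->
    (forall v, v \in S1 -> min_degree_bfs_tree E' v (p v)) ->
    (forall v, v \in S1 -> tree_weights E' v (p v) (f v)) ->
    greedy_dominating (path_incidence E' p) A (path_nodes R E' S1 p f) S2 ->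
    (forall x, x \in S2 -> bfs_tree E' x (q x)) ->
    spanner_construction R E
      (H1 :|: light_edges R A E' :|: dominator_edges R A E' c
          :|: \bigcup_(x in S2) tree_edges E' x (q x)
          :|: cheap_path_edges R E' S1 p f).

(* Main.v *)
(* A walk that loses a vertex in Step 1 is served, with error 2, by the tree
   added when its first vertex is removed.  On a walk that survives, only the
   part between its first and last heavy vertices x and y matters; let a and b
   be their dominators, k the length of that part and T the path threshold.
   If f(a,b) <= 5T, Step 7 gives error 4.  Otherwise, let Q be a tree path of
   T_a whose weight exceeds 4T.  The vertex where f(a,.) first exceeds T has a
   subtree of weight more than 3T, so some vertex of S2 is adjacent to Q.
   If dist(a,b) <= k + 1, the tree path to b serves as Q, and the detours
   x-a and b-y give error 5.  If dist(a,b) = k + 2, appending b to the tree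
   path from a to y gives a shortest path from a to b, so minimality of the
   weights gives f(a,y) >= f(a,b) - deg b > 4T; the tree path to y then serves
   as Q, the detour b-y is saved, and the error is 4. *)

Require Import Defs.
From mathcomp Require Import all_boot all_order all_algebra.
From mathcomp Require Import all_classical all_reals all_analysis.
From mathcomp Require Import zify lra.
(* MathComp-Analysis shadows the names [arc], [induced], [subsetP], [set0]. *)
From mathcomp Require Import fintype finset.
Require Import Defs.

Set Implicit Arguments.
Unset Strict Implicit.
Unset Printing Implicit Defensive.

Import Order.TTheory GRing.Theory Num.Theory.
Local Open Scope ring_scope.

(** * Walks of bounded length *)

(** A natural-number bound on the distance: it avoids the extended reals, and a disconnected pair
    simply satisfies no bound. *)
Definition within (V : finType) (E : {set {set V}}) (n : nat) (u v : V) :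
    Prop :=
  exists2 s, walk (adj E) u v s & (size s <= n)%N.

Lemma adj_sym (V : finType) (E : {set {set V}}) : symmetric (adj E).
Proof. by move=> x y; rewrite /adj setUC. Qed.

Lemma walk_cat (V : finType) (r : rel V) (u v w : V) (s t : seq V) :
  walk r u v s -> walk r v w t -> walk r u w (s ++ t).
Proof.
move=> /andP[us /eqP vE] /andP[vt wE].
by rewrite /walk cat_path last_cat vE us vt.
Qed.

Lemma walk_connect (V : finType) (r : rel V) (u v : V) (s : seq V) :
  walk r u v s -> connect r u v.
Proof. by move=> /andP[us /eqP <-]; apply/connectP; exists s. Qed.

Lemma within0 (V : finType) (E : {set {set V}}) (n : nat) (u : V) :
  within E n u u.
Proof. by exists [::]; rewrite // /walk /=. Qed.

Lemma within_adj (V : finType) (E : {set {set V}}) (u v : V) :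
  adj E u v -> within E 1 u v.
Proof. by move=> uv; exists [:: v]; rewrite // /walk /= uv eqxx. Qed.

Lemma within_dominates (V : finType) (E : {set {set V}}) (u v : V) :
  dominates E u v -> within E 1 u v.
Proof. by case/orP=> [/eqP <-|/within_adj//]; apply: within0. Qed.

Lemma within_sym (V : finType) (E : {set {set V}}) (n : nat) (u v : V) :
  within E n u v -> within E n v u.
Proof.
case=> s /andP[us /eqP <-] sn; exists (rev (belast u s)).
  rewrite /walk (eq_path (e' := fun x y => adj E y x)) => [|x y]; last first.
    exact: adj_sym.
  rewrite rev_path us /=.
  by case: s {us sn} => //= x s; rewrite rev_cons last_rcons.
by rewrite size_rev size_belast.
Qed.

Lemma within_trans (V : finType) (E : {set {set V}}) (m n : nat) (u v w : V) :
  within E m u v -> within E n v w -> within E (m + n) u w.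
Proof.
move=> [s us sm] [t vt tn]; exists (s ++ t); first exact: walk_cat us vt.
by rewrite size_cat leq_add.
Qed.

Lemma within_leq (V : finType) (E : {set {set V}}) (m n : nat) (u v : V) :
  (m <= n)%N -> within E m u v -> within E n u v.
Proof. by move=> mn [s us sm]; exists s => //; apply: leq_trans mn. Qed.

Lemma within_sub (V : finType) (E F : {set {set V}}) (n : nat) (u v : V) :
  E \subset F -> within E n u v -> within F n u v.
Proof.
move=> EF [s /andP[us vE] sn]; exists s => //; rewrite /walk vE andbT.
by apply: sub_path us => x y; exact: (subsetP EF).
Qed.

Lemma within_in_tree (V : finType) (E : {set {set V}}) (n : nat) (u v : V) :
  within E n u v -> in_tree E u v.
Proof. by case=> s /walk_connect. Qed.

Lemma additive_spanner_within (R : realType) (V : finType) (k : nat)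
    (E H : {set {set V}}) :
  H \subset E ->
  (forall n u v, within E n u v -> within H (n + k) u v) ->
  additive_spanner R k E H.
Proof.
(* Moved to the left, [k] turns the claim into a lower bound for all lengths of [E]-walks; a
   disconnected pair has none to check. *)
move=> HE stretch; split=> // u v; rewrite -leeBlDr //.
apply: le_ereal_inf_tmp => _ [s us <-]; rewrite leeBlDr //.
have [|t ut tk] := stretch (size s) u v; first by exists s.
apply: (@le_trans _ _ ((size t)%:R)%:E).
  by apply: ereal_inf_lbound; exists t.
by rewrite -EFinD lee_fin -natrD ler_nat.
Qed.

(** * Induced subgraphs, geodesics and BFS trees *)

Lemma induced_sub (V : finType) (E : {set {set V}}) (A : {set V}) :
  induced E A \subset E.
Proof. by apply/subsetP=> d; rewrite inE => /andP[]. Qed.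

Lemma path_induced (V : finType) (E : {set {set V}}) (A : {set V}) (u : V)
    (s : seq V) :
  path (adj E) u s -> {subset u :: s <= A} -> path (adj (induced E A)) u s.
Proof.
elim: s u => //= x s IHs u /andP[ux xs] sA; apply/andP; split.
  rewrite /adj inE [_ \in E]ux; apply/subsetP=> y.
  by rewrite !inE => yux; apply: sA; rewrite !inE orbA yux.
by apply: IHs xs _ => y ys; apply: sA; rewrite inE ys orbT.
Qed.

(** Cutting out cycles leaves a duplicate-free walk on a subset of the vertices; minimality makes it
    no shorter than [s], so nothing was cut. *)
Lemma geodesic_uniq (V : finType) (E : {set {set V}}) (u v : V) (s : seq V) :
  geodesic E u v s -> uniq (u :: s).
Proof.
case=> /andP[us /eqP vE] smin.
case/shortenP: us vE => t ut uniq_t ts vE.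
apply: (leq_size_uniq uniq_t) => [x|]; last first.
  by rewrite ltnS; apply: smin; rewrite /walk ut vE eqxx.
by rewrite !inE => /orP[->//|/ts ->]; rewrite orbT.
Qed.

(** [F] is left open so that it can hold a whole tree or a single tree path; for the latter only
    ancestors of [y] may be asked for. *)
Lemma within_arc_path (V : finType) (E F : {set {set V}}) (v x y : V)
    (p : V -> V) (s : seq V) :
  walk (arc E v p) x y s ->
  (forall z, z != v -> in_tree E v z -> connect (arc E v p) z y ->
     [set p z; z] \in F) ->
  walk (adj F) x y s.
Proof.
elim: s x => [//|z s IHs] x; rewrite /walk /= -andbA => /and3P[xz zs yE] treeF.
have zy : connect (arc E v p) z y by apply: (walk_connect (s := s)); apply/andP.
case/and3P: xz => vz zv /eqP xE.
have /andP[-> ->] := IHs z (introT andP (conj zs yE)) treeF.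
by rewrite !andbT /adj -xE treeF.
Qed.

(** The tree walk to [y] is also a walk of [E], so its last step is both the arc from [p y] and an
    edge. *)
Lemma bfs_tree_edge (V : finType) (E : {set {set V}}) (v y : V) (p : V -> V) :
  bfs_tree E v p -> in_tree E v y -> y != v -> [set p y; y] \in E.
Proof.
move=> bfs /bfs[s []]; case/lastP: s => [|s z].
  by rewrite /walk /= => /eqP ->; rewrite eqxx.
rewrite /walk !rcons_path last_rcons => /andP[/andP[_ arcz] /eqP <-] [+ _] _.
rewrite /walk rcons_path => /andP[/andP[_ adjz] _].
by case/and3P: arcz => _ _ /eqP ->.
Qed.

Lemma tree_edges_sub (V : finType) (E : {set {set V}}) (v : V) (p : V -> V) :
  bfs_tree E v p -> tree_edges E v p \subset E.
Proof.
move=> bfs; apply/subsetP=> _ /imsetP[y + ->]; rewrite inE => /andP[vy yv].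
exact: bfs_tree_edge bfs vy yv.
Qed.

Lemma in_tree_parent (V : finType) (E : {set {set V}}) (v w u : V)
    (p : V -> V) :
  bfs_tree E v p -> in_tree E v u -> connect (arc E v p) w u -> in_tree E v w.
Proof.
move=> bfs vu /connectP[[|z s] /= + uE]; first by rewrite -uE.
case/andP=> /and3P[vz zv /eqP <-] _.
apply: (connect_trans vz); apply: connect1.
by rewrite adj_sym; exact: bfs_tree_edge bfs vz zv.
Qed.

Lemma tree_path_edges_sub (V : finType) (E : {set {set V}}) (v u : V)
    (p : V -> V) :
  bfs_tree E v p -> in_tree E v u -> tree_path_edges E v p u \subset E.
Proof.
move=> bfs vu; apply/subsetP=> _ /imsetP[w + ->]; rewrite !inE => /andP[wv wu].
exact: bfs_tree_edge bfs (in_tree_parent bfs vu wu) wv.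
Qed.

Lemma within_bfs_tree (V : finType) (E : {set {set V}}) (v u : V)
    (p : V -> V) (n : nat) :
  bfs_tree E v p -> within E n v u -> within (tree_edges E v p) n v u.
Proof.
move=> bfs vu; have [s [vs [_ smin]]] := bfs _ (within_in_tree vu).
exists s; last by case: vu => t /smin st tn; apply: leq_trans tn.
apply: within_arc_path vs _ => z zv vz _.
by apply/imsetP; exists z; rewrite ?inE ?vz.
Qed.

(** A BFS tree keeps the distances from its root, so a detour through the hub [v] costs in [H] what
    it costs in [E]. *)
Lemma within_hub (V : finType) (E H : {set {set V}}) (v u w : V) (p : V -> V)
    (m n : nat) :
  bfs_tree E v p -> tree_edges E v p \subset H ->
  within E m v u -> within E n v w -> within H (m + n) u w.
Proof.
move=> bfs treeH vu vw; apply: (within_sub treeH).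
apply: within_trans (within_bfs_tree bfs vw).
exact/within_sym/(within_bfs_tree bfs).
Qed.

Lemma path_within_cat (V : finType) (E : {set {set V}}) (u z : V)
    (s : seq V) :
  path (adj E) u s -> z \in u :: s ->
  exists i j, [/\ (i + j = size s)%N, within E i u z
    & within E j z (last u s)].
Proof.
move=> us; rewrite inE => /orP[/eqP->|].
  exists 0%N, (size s); split; rewrite ?add0n //; first exact: within0.
  by exists s; rewrite // /walk us eqxx.
move=> zs; case/splitPr: zs us => s1 s2.
rewrite -cat_rcons cat_path last_cat last_rcons size_cat => /andP[us1 zs2].
exists (size (rcons s1 z)), (size s2); split=> //.
  by exists (rcons s1 z); rewrite // /walk us1 last_rcons eqxx.
by exists s2; rewrite // /walk zs2 eqxx.
Qed.

(** * The removal loop and the walks it destroys *)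

Lemma removal_loop_sub (R : realType) (V : finType) (E : {set {set V}})
    (A : {set V}) (H : {set {set V}}) :
  removal_loop R E A H -> H \subset E.
Proof.
elim=> [|{}A {}H v p _ HE _ _ _ bfs]; first exact: sub0set.
rewrite subUset HE /=.
exact: subset_trans (tree_edges_sub bfs) (induced_sub E A).
Qed.

Lemma removal_loop_within (R : realType) (V : finType) (E : {set {set V}})
    (A : {set V}) (H : {set {set V}}) (u : V) (s : seq V) :
  removal_loop R E A H -> path (adj E) u s ->
  {subset u :: s <= A} \/ within H (size s + 2) u (last u s).
Proof.
move=> loop us; elim: loop => [|{}A {}H v p _ IH vA _ _ bfs].
  by left=> x _; rewrite inE.
case: IH => [sA|]; last by right; apply: within_sub (subsetUl _ _) _.
have [/hasP[z zs vz]|/hasPn notdom] :=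
  boolP (has (dominates (induced E A) v) (u :: s)); last first.
  by left=> x xs; rewrite inE inE (sA x xs) andbT; exact: notdom.
(* The whole path still lies in the current graph, so the new tree serves both halves; the step
   between [v] and [z] is counted twice, which is the error 2. *)
right; have [i [j [ijs uz zl]]] := path_within_cat (path_induced us sA) zs.
have {}vz := within_dominates vz.
apply: within_leq
  (within_hub bfs (subsetUr _ _) (within_trans vz (within_sym uz))
                                 (within_trans vz zl)).
by rewrite -ijs; lia.
Qed.

(** * Light edges and the reduction to heavy pairs *)

Lemma light_edge (R : realType) (V : finType) (E : {set {set V}})
    (A : {set V}) (u v : V) :
  let E' := induced E A in
  adj E' u v -> u \notin heavy R A E' -> adj (light_edges R A E') u v.
Proof.
move=> E' uv uNh; rewrite /adj inE [_ \in E']uv; apply/existsP; exists u.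
rewrite set21 andbT in_setD uNh /=.
by move: uv; rewrite /adj inE => /andP[_ /subsetP->]; rewrite // !inE eqxx.
Qed.

(** Edges before the first heavy vertex leave light vertices, so they belong to [H]. The last vertex
    of the walk is not tested, since no edge leaves it. *)
Lemma within_first_heavy (R : realType) (V : finType) (E H : {set {set V}})
    (A : {set V}) (n : nat) (u v : V) :
  let E' := induced E A in
  light_edges R A E' \subset H -> within E' n u v ->
  within H n u v \/
  exists x i k, [/\ x \in heavy R A E', (i + k <= n)%N, within H i u x
    & within E' k x v].
Proof.
move=> E' lightH [s us sn]; elim: s u n us sn => [|x s IHs] u n.
  by move=> /eqP /= -> _; left; apply: within0.
move=> us sn; have [uh|uNh] := boolP (u \in heavy R A E').
  right; exists u, 0%N, n; split=> //; first exact: within0.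
  by exists (x :: s).
move: us; rewrite /walk /= -andbA => /and3P[ux xs vE].
case: n sn => // n sn.
have {}ux : within H 1 u x.
  exact/within_adj/(subsetP lightH)/light_edge.
case: (IHs x n _ sn) => [|xv|[y [i [k [yh ikn xy yv]]]]].
- by rewrite /walk xs.
- by left; apply: within_trans ux xv.
- right; exists y, (1 + i)%N, k; split=> //.
  exact: within_trans ux xy.
Qed.

Lemma within_heavy_ends (R : realType) (V : finType) (E H : {set {set V}})
    (A : {set V}) (d n : nat) (u v : V) :
  let E' := induced E A in
  light_edges R A E' \subset H ->
  (forall k x y, x \in heavy R A E' -> y \in heavy R A E' ->
     within E' k x y -> within H (k + d) x y) ->
  within E' n u v -> within H (n + d) u v.
Proof.
move=> E' lightH stretch uv.
have [{}uv|[x [i [k [xh ikn ux xv]]]]] := within_first_heavy lightH uv.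
  exact: within_leq (leq_addr _ _) uv.
(* Read backwards from [v], the rest of the walk shows its last heavy vertex [y]; only the piece
   between [x] and [y] incurs the error [d]. *)
have [vx|[y [j [l [yh jlk vy yx]]]]] :=
  within_first_heavy lightH (within_sym xv).
  by apply: within_leq (within_trans ux (within_sym vx)); lia.
have xy := stretch _ _ _ xh yh (within_sym yx).
by apply: within_leq (within_trans ux (within_trans xy (within_sym vy))); lia.
Qed.

(** * Degree thresholds and greedy domination *)

Lemma removal_threshold_le (R : realType) (n : nat) :
  (1 < n)%N -> removal_threshold R n <= path_threshold R n.
Proof.
move=> n1; have n0 : (0 : R) < n%:R by rewrite ltr0n; lia.
have ln2 : 0 < ln (2 : R) by rewrite ln_gt0 // ltr1n.
(* From two vertices on, the binary logarithm is at least 1, so dividing by its power yields at most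
   what multiplying yields. *)
have L1 : 1 <= log2 R n.
  by rewrite /log2 ler_pdivlMr // mul1r ler_ln ?posrE ?ler_nat.
have pow1 (a : R) : 0 <= a -> 1 <= log2 R n `^ a.
  move=> a0; rewrite -(powRr0 (log2 R n)).
  by rewrite ler_powR.
rewrite /removal_threshold /path_threshold ler_wpM2l ?powR_ge0 //.
apply: (@le_trans _ _ 1); last by apply: pow1; lra.
by rewrite invf_le1 ?(lt_le_trans ltr01) ?pow1 //; lra.
Qed.

Lemma greedy_partial_sub (T W : finType) (cov : T -> W -> bool) (C : {set T})
    (X : {set W}) (S : {set T}) :
  greedy_partial cov C X S -> S \subset C.
Proof.
by elim=> [|{}S x _ SC _ xC _]; rewrite ?sub0set // subUset sub1set xC.
Qed.

Lemma greedy_dominatingP (T W : finType) (cov : T -> W -> bool) (C : {set T})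
    (X : {set W}) (S : {set T}) (y : W) :
  greedy_dominating cov C X S -> y \in X -> exists2 x, x \in S & cov x y.
Proof.
move=> [_ /setP/(_ y)]; rewrite !inE => + yX; rewrite yX /=.
by move/negbT; rewrite negb_forall_in => /exists_inP[x xS /negPn]; exists x.
Qed.

(** * Tree weights and hubs of heavy paths *)

Lemma arc_path_weight (V : finType) (E : {set {set V}}) (v x : V)
    (p : V -> V) (f : V -> nat) (s : seq V) :
  tree_weights E v p f -> path (arc E v p) x s ->
  f (last x s) = (f x + \sum_(z <- s) deg E z)%N.
Proof.
move=> [_ fE]; elim: s x => [|y s IHs] x /=; first by rewrite big_nil addn0.
case/andP=> /and3P[vy yv /eqP pE] ys.
by rewrite (IHs _ ys) big_cons fE // pE addnA.
Qed.

Lemma tree_walk_weight (V : finType) (E : {set {set V}}) (v u : V)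
    (p : V -> V) (f : V -> nat) (s : seq V) :
  tree_weights E v p f -> walk (arc E v p) v u s -> f u = walk_weight E v s.
Proof.
move=> ftree /andP[vs /eqP <-]; rewrite (arc_path_weight ftree vs).
by rewrite /walk_weight big_cons; case: ftree => ->.
Qed.

(** Parents are unique, so going up from [w] both walks visit the same vertices; no arc enters the
    root, so [s] cannot stop short of [z]. *)
Lemma ancestor_in_walk (V : finType) (E : {set {set V}}) (v w z : V)
    (p : V -> V) (s : seq V) :
  walk (arc E v p) v w s -> connect (arc E v p) z w -> z \in v :: s.
Proof.
move=> vs /connectP[t]; elim/last_ind: t w s vs => [|t y IHt] w s vs.
  by move=> _ /= <-; case/andP: vs => _ /eqP <-; apply: mem_last.
rewrite rcons_path last_rcons => /andP[zt /and3P[_ yv /eqP yE]] wy.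
subst w; case/lastP: s vs => [|s x]; rewrite /walk.
  by move=> /= /eqP vy; rewrite vy eqxx in yv.
rewrite rcons_path last_rcons => /andP[/andP[vs /and3P[_ _ /eqP xE]] /eqP xy].
subst x; have /(_ (last v s)) := IHt _ s; rewrite /walk vs eqxx -xE yE.
by move=> /(_ isT zt erefl); rewrite -rcons_cons mem_rcons inE orbC => ->.
Qed.

Lemma first_exceeding (R : realType) (V : finType) (f : V -> nat) (T : R)
    (v : V) (s : seq V) :
  (f v)%:R <= T -> T < (f (last v s))%:R ->
  exists s1 w s2, [/\ s = s1 ++ w :: s2, (f (last v s1))%:R <= T
    & T < (f w)%:R].
Proof.
elim: s v => [|x s IHs] v fv /=; first by rewrite ltNge fv.
have [fx fl|fx _] := leP (f x)%:R T; last by exists [::], x, s.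
have [s1 [w [s2 [-> fs1 fw]]]] := IHs x fx fl.
by exists (x :: s1), w, s2.
Qed.

Lemma sum_uniq_le (V : finType) (F : V -> nat) (B : {set V}) (s : seq V) :
  uniq s -> {subset s <= B} -> (\sum_(x <- s) F x <= \sum_(x in B) F x)%N.
Proof.
move=> uniq_s sB; rewrite big_uniq //= (bigID (mem s) (mem B)) /=.
apply: leq_trans (leq_addr _ _); apply/eq_leq/eq_bigl => x.
by rewrite andb_idl // => /sB.
Qed.

Lemma heavy_path_hub (R : realType) (V : finType) (E' : {set {set V}})
    (S1 S2 C : {set V}) (p : V -> V -> V) (f : V -> V -> nat) (v t : V)
    (s : seq V) :
  greedy_dominating (path_incidence E' p) C (path_nodes R E' S1 p f) S2 ->
  v \in S1 -> bfs_tree E' v (p v) -> tree_weights E' v (p v) (f v) ->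
  walk (arc E' v (p v)) v t s -> geodesic E' v t s ->
  (deg E' v)%:R <= path_threshold R #|V| ->
  4 * path_threshold R #|V| < (f v t)%:R ->
  exists x i j, [/\ x \in S2, (i + j <= size s + 2)%N, within E' i x v
    & within E' j x t].
Proof.
move=> gd vS bfs ftree vs geo degv ft.
set T := path_threshold R #|V| in degv ft *.
have T0 : 0 <= T by rewrite mulr_ge0 ?powR_ge0.
have /andP[/= pvs /eqP tE] := vs.
have [s1 [w [s2 [sE fs1 fw]]]] : exists s1 w s2,
    [/\ s = s1 ++ w :: s2, (f v (last v s1))%:R <= T & T < (f v w)%:R].
  by apply: first_exceeding; [case: ftree => -> | rewrite tE; lra].
move: (pvs); rewrite sE cat_path /= => /and3P[vs1 aw ws2].
have /and3P[vw wv /eqP pw] := aw.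
have s2w : last w s2 = t by rewrite -tE sE last_cat.
(* The vertices from [w] to [t] are descendants of [w], distinct because the walk is a geodesic. *)
have sumle : (\sum_(x <- w :: s2) deg E' x <= subtree_weight E' v (p v) w)%N.
  apply: sum_uniq_le => [|x].
    by move: (geodesic_uniq geo); rewrite sE /= cat_uniq => /and4P[].
  by move=> /(path_connect ws2) wx; rewrite inE.
have fE : f v t = (f v (last v s1) + \sum_(x <- w :: s2) deg E' x)%N.
  by rewrite -(arc_path_weight (x := last v s1) ftree) /= ?s2w ?aw ?ws2.
have node : (v, w) \in path_nodes R E' S1 p f.
  rewrite inE /= vS vw wv fw pw fs1 /= -/T.
  (* Of the more than [4T] collected up to [t], at most [T] lies before [w]; more than [3T] is left
     for the subtree of [w]. *)
  move: ft sumle; rewrite fE natrD -(ler_nat R) => ft sumle; lra.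
have [x xS /exists_inP[z]] := greedy_dominatingP gd node; rewrite inE /=.
move=> zw xz; have zs : z \in v :: s.
  have: z \in v :: rcons s1 w.
    apply: ancestor_in_walk zw.
    by rewrite /walk rcons_path vs1 aw last_rcons eqxx.
  by rewrite sE -cat_rcons -cat_cons mem_cat => ->.
case: geo => /andP[gs _] _.
have [i [j [ijs vz zt]]] := path_within_cat gs zs.
have {}xz := within_adj xz; rewrite tE in zt.
(* The edge from [x] to [z] is taken towards both ends, hence the [+ 2]. *)
exists x, (1 + i)%N, (1 + j)%N; split.
- exact: xS.
- by rewrite addnACA ijs addnC sE.
- exact: within_trans xz (within_sym vz).
- exact: within_trans xz zt.
Qed.

(** Extending [t] by [w] gives a walk no longer than the geodesic [s], hence a geodesic that the
    tree path to [w] must not outweigh. *)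
Lemma geodesic_rcons_weight (V : finType) (E' : {set {set V}}) (v y w : V)
    (p : V -> V) (f : V -> nat) (s t : seq V) :
  min_degree_bfs_tree E' v p -> tree_weights E' v p f ->
  walk (arc E' v p) v w s -> geodesic E' v w s ->
  walk (arc E' v p) v y t -> geodesic E' v y t -> adj E' y w ->
  (size t < size s)%N -> (f w <= f y + deg E' w)%N.
Proof.
move=> [_ minw] ftree vs [_ smin] vt [/andP[gt /eqP yE] _] yw ts.
rewrite (tree_walk_weight ftree vs) (tree_walk_weight ftree vt).
suff /(minw _ _ _ vs) : geodesic E' v w (rcons t w).
  by rewrite /walk_weight -rcons_cons -cats1 big_cat big_seq1.
split; first by rewrite /walk rcons_path gt last_rcons eqxx yE yw.
by move=> r /smin; apply: leq_trans; rewrite size_rcons.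
Qed.

(** * The spanner bound *)

Theorem theorem2 (R : realType) (V : finType) (E H : {set {set V}}) :
  simple_graph E -> spanner_construction R E H -> additive_spanner R 5 E H.
Proof.
move=> _ [A H1 S1 c p f S2 q E' [loop degA] gd1 domc minp fp gd2 bfsq].
have bfsp v : v \in S1 -> bfs_tree E' v (p v) by case/minp.
have S1A : {subset S1 <= A} by case: gd1 => /greedy_partial_sub/subsetP.
set LE := light_edges _ _ _; set DE := dominator_edges _ _ _ _.
set BE := \bigcup_(x in S2) _; set CE := cheap_path_edges _ _ _ _ _.
have E'E : E' \subset E := induced_sub E A.
apply: additive_spanner_within => [|n u v [s /andP[us /eqP vE] sn]].
  rewrite !subUset (removal_loop_sub loop) /= -!andbA; apply/and4P; split.
  - by apply: subset_trans E'E; apply/subsetP=> d; rewrite inE => /andP[].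
  - apply: subset_trans E'E; apply/subsetP=> _ /imsetP[w + ->].
    rewrite inE => /andP[/domc[_ /orP[->//|cw _]]].
    by rewrite setUC.
  - apply: subset_trans E'E; apply/bigcupsP=> x xS.
    exact/tree_edges_sub/bfsq.
  - apply: subset_trans E'E; apply/bigcupsP=> x xS.
    apply/bigcupsP=> y /andP[_ /andP[xy _]].
    exact/tree_path_edges_sub/xy/bfsp.
(* Distinct [u] and [v] supply the two vertices that the comparison of thresholds requires. *)
have [<-|uv] := eqVneq u v; first exact: within0.
set HH := _ :|: CE.
have H1H : H1 \subset HH by rewrite /HH -!setUA subsetUl.
have LEH : LE \subset HH.
  by apply/subsetP=> d dL; rewrite !in_setU dL !orbT.
have DEH : DE \subset HH.
  by apply/subsetP=> d dL; rewrite !in_setU dL !orbT.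
have BEH : BE \subset HH.
  by apply/subsetP=> d dL; rewrite !in_setU dL !orbT.
have CEH : CE \subset HH by rewrite /HH subsetUr.
have n1 : (1 < #|V|)%N.
  by rewrite (cardD1 u) (cardD1 v) !inE eq_sym uv.
case: (removal_loop_within loop us) => [sA|]; last first.
  by rewrite vE => /(within_sub H1H); apply: within_leq; rewrite leq_add.
have {us sA vE sn}: within E' n u v.
  by exists s => //; rewrite /walk path_induced // vE eqxx.
apply: (within_heavy_ends LEH) => {n u v uv s} k x y xh yh xy.
set T := path_threshold R #|V|.
(* Vertices of [S1] survive the removal phase, so their degrees lie below the removal threshold. *)
have degT v : v \in S1 -> (deg E' v)%:R < T.
  move=> /S1A/degA/lt_le_trans; apply; exact: removal_threshold_le.
have [cxS cxx] := domc _ xh; have [cyS cyy] := domc _ yh.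
set a := c x in cxS cxx; set b := c y in cyS cyy.
have ax := within_dominates cxx; have by_ := within_dominates cyy.
have ay : within E' (1 + k) a y := within_trans ax xy.
have ab : within E' (1 + k + 1) a b := within_trans ay (within_sym by_).
have hub w i j : w \in S2 -> within E' i w x -> within E' j w y ->
    (i + j <= k + 5)%N -> within HH (k + 5) x y.
  move=> wS wx wy /within_leq; apply; apply: within_hub wx wy; first exact: bfsq.
  by apply: subset_trans BEH; apply: bigcup_sup.
have [s [as_ geos]] := bfsp _ cxS _ (within_in_tree ab).
have sk : (size s <= 1 + k + 1)%N.
  by case: ab => t /(proj2 geos); apply: leq_trans.
have [fab|fab] := leP (f a b)%:R (5 * T).
  have toc w : w \in heavy R A E' -> within HH 1 w (c w).
    move=> wh; have [->|cw] := eqVneq (c w) w; first exact: within0.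
    apply/within_adj/(subsetP DEH)/imsetP; exists w => //.
    by rewrite inE wh.
  have xab : within HH (size s) a b.
    apply: (within_sub CEH); exists s => //.
    apply: within_arc_path as_ _ => z za az zb.
    apply/bigcupP; exists a => //; apply/bigcupP; exists b.
      by rewrite cyS (within_in_tree ab).
    by apply/imsetP; exists z; rewrite // !inE za.
  have := within_trans (toc _ xh) (within_trans xab (within_sym (toc _ yh))).
  by apply: within_leq; move: sk; clear; lia.
(* If [size s] is at most [k + 1], the detour between [a] and [b] costs at most [k + 3], and
   reaching [x] and [y] adds at most 2. *)
have [sk1|ks] := leqP (size s) (1 + k).
  have [||w [i [j [wS ijs wa wb]]]] :=
    heavy_path_hub gd2 cxS (bfsp _ cxS) (fp _ cxS) as_ geos.
  - exact/ltW/degT.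
  (* [T] is positive because it exceeds a degree, so [5T] is above [4T]. *)
  - by have := degT _ cxS; have := ler0n R (deg E' a); rewrite -/T; lra.
  apply: (hub w _ _ wS (within_trans wa ax) (within_trans wb by_)).
  by move: ijs sk1; clear; lia.
have [t [at_ geot]] := bfsp _ cxS _ (within_in_tree ay).
have tk : (size t <= 1 + k)%N.
  by case: ay => r /(proj2 geot); apply: leq_trans.
(* If [b = y], then [b] would be within [1 + k] of [a], contrary to [ks]. *)
have yb : adj E' y b.
  rewrite adj_sym; case/orP: cyy => [/eqP bE|//].
  move: ks; rewrite ltnNge; case: ay => r; rewrite -bE => /(proj2 geos) sr rk.
  by rewrite (leq_trans sr rk).
have fay := geodesic_rcons_weight (minp _ cxS) (fp _ cxS) as_ geos at_ geot yb
  (leq_ltn_trans tk ks).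
have [||w [i [j [wS ijs wa wy]]]] :=
  heavy_path_hub gd2 cxS (bfsp _ cxS) (fp _ cxS) at_ geot.
- exact/ltW/degT.
(* Here the constant 5 of the last step of the construction pays off: losing [deg b < T] still
   leaves [f a y] above [4T]. *)
- have := degT _ cyS; move: fay; rewrite -(ler_nat R) natrD -/T => fay db; lra.
apply: (hub w _ _ wS (within_trans wa ax) wy).
by move: ijs tk; clear; lia.
Qed.
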